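(* Let $\{f(\cdot;\theta,\gamma)\colon \theta\in\Theta,\gamma\in\Gamma\}$ be a parametric family of probability densities with respect to a $\sigma$-finite measure on a measurable space, fix $\eta_0\in\Theta$, $\gamma_0\in\Gamma$, and let $\boldsymbol X_1,\boldsymbol X_2,\ldots$ be independent with common density $f(\cdot;\eta_0,\gamma_0)$. Let $r(\cdot;\theta)$, $v_\theta$, $\Theta_v$, $S_n(\theta)$, $\Lambda_n^p(\theta)$ and $\Lambda_n^s$ be as defined in the context. Suppose that for each fixed $\theta\in\Theta\cap\Theta_v$ (with $v_\theta>0$, so that $S_n(\theta)$ is defined), $$2\Lambda_n^p(\theta)=\max\left[0,S_n(\theta)\right]^2+o_p(1)\qquad (n\to\infty),$$ and that there exists a sequence $\{\theta_i\}$ with each $\theta_i\in\Theta\cap\Theta_v$ such that $v_{\theta_i}\to\infty$ as $i\to\infty$. Then $\Lambda_n^s\to\infty$ in probability as $n\to\infty$, that is, $P\{\Lambda_n^s\le M\}\to 0$ for each $0<M<\infty$.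
   Context: All probabilities, expectations and variances (subscript $0$) are under the null hypothesis that the observations are independent with density $f(\cdot;\eta_0,\gamma_0)$; $o_p(1)$ denotes a sequence converging to $0$ in probability. Density ratio: $r(\cdot;\theta)=f(\cdot;\theta,\gamma_0)/f(\cdot;\eta_0,\gamma_0)$. It is assumed that $E_0[r(\boldsymbol X_1;\theta)]=1$ for all $\theta\in\Theta$. Score variance: $v_\theta=E_0[r(\boldsymbol X_1;\theta)^2]-1=\mathrm{Var}_0[r(\boldsymbol X_1;\theta)]\in[0,\infty]$, and $\Theta_v=\{\theta\colon v_\theta<\infty\}$. Standardised score: for $\theta\in\Theta_v$ with $v_\theta>0$, $S_n(\theta)=(nv_\theta)^{-1/2}\sum_{i=1}^n[r(\boldsymbol X_i;\theta)-1]$. Two-component mixture density: $g(\cdot;p,\eta_0,\theta,\gamma_0)=(1-p)f(\cdot;\eta_0,\gamma_0)+p f(\cdot;\theta,\gamma_0)$, $0\le p\le1$. Profile log-likelihood ratio statistic: $\Lambda_n^p(\theta)=\sup_{0\le p\le 1}\sum_{i=1}^n\log g(\boldsymbol X_i;p,\eta_0,\theta,\gamma_0)-\sum_{i=1}^n\log f(\boldsymbol X_i;\eta_0,\gamma_0)$. Log-likelihood ratio statistic for one versus two components with known null component: $\Lambda_n^s=\sup_{0\le p\le1,\ \theta\in\Theta}\sum_{i=1}^n\log g(\boldsymbol X_i;p,\eta_0,\theta,\gamma_0)-\sum_{i=1}^n\log f(\boldsymbol X_i;\eta_0,\gamma_0)$. *)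

(* Defs.v *)
From mathcomp Require Export all_boot all_order all_algebra.
From mathcomp Require Export all_classical all_reals all_analysis.

Set Implicit Arguments.
Unset Strict Implicit.
Unset Printing Implicit Defensive.
Import Order.TTheory GRing.Theory Num.Theory.
Import numFieldNormedType.Exports.

Local Open Scope classical_set_scope.
Local Open Scope ring_scope.

Definition is_density {d} {T : measurableType d} {R : realType}
    (mu : {measure set T -> \bar R}) (h : T -> R) : Prop :=
  [/\ measurable_fun setT h, (forall x, 0 <= h x)
    & (\int[mu]_x (h x)%:E = 1)%E].

Definition has_density {d d'} {Omega : measurableType d} {T : measurableType d'}
    {R : realType} (P : probability Omega R) (mu : {measure set T -> \bar R})
    (Y : {RV P >-> T}) (h : T -> R) : Prop :=
  forall A : set T, measurable A ->
    P (Y @^-1` A) = (\int[mu]_(x in A) (h x)%:E)%E.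

Definition mutually_independent {d d'} {Omega : measurableType d}
    {T : measurableType d'} {R : realType} (P : probability Omega R)
    (X : nat -> {RV P >-> T}) : Prop :=
  forall (J : seq nat) (A : nat -> set T),
    uniq J -> (forall i, measurable (A i)) ->
    P (\bigcap_(i in [set` J]) X i @^-1` A i) =
    (\prod_(i <- J) P (X i @^-1` A i))%E.

(* A supremum over an uncountable, unstructured parameter set need not be
   measurable, so both modes of convergence use the outer probability
   [mu_ext P], which is [P] itself on measurable events (by
   [measurable_mu_extE]). *)
Definition is_op1 {d} {Omega : measurableType d} {R : realType}
    (P : probability Omega R) (Z : nat -> Omega -> \bar R) : Prop :=
  forall e : R, 0 < e ->
    mu_ext P [set w | (e%:E < `|Z n w|)%E] @[n --> \oo] --> 0%E.

Definition cvg_pinfty_in_probability {d} {Omega : measurableType d}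
    {R : realType} (P : probability Omega R) (Y : nat -> Omega -> \bar R) :
    Prop :=
  forall M : R, 0 < M ->
    mu_ext P [set w | (Y n w <= M%:E)%E] @[n --> \oo] --> 0%E.

Section statistics.
Context {d d'} {Omega : measurableType d} {T : measurableType d'}
  {R : realType} {Theta Gamma : Type}.
Context (f : Theta -> Gamma -> T -> R) (eta0 : Theta) (gamma0 : Gamma).
(* [X i] is the observation numbered [i + 1] in one-based indexing. *)
Context (P : probability Omega R) (X : nat -> {RV P >-> T}).

(* Equal to 0 where the null density vanishes, an event of probability 0. *)
Definition density_ratio (theta : Theta) (x : T) : R :=
  f theta gamma0 x / f eta0 gamma0 x.

Definition score_variance (theta : Theta) : \bar R :=
  ('E_P[fun w => (density_ratio theta (X 0%N w) ^+ 2)%R] - 1)%E.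

Definition finite_variance_set : set Theta :=
  [set theta | (score_variance theta < +oo)%E].

(* Only meaningful when the score variance is positive and finite. *)
Definition std_score (n : nat) (theta : Theta) (w : Omega) : R :=
  (Num.sqrt (n%:R * fine (score_variance theta)))^-1 *
  \sum_(i < n) (density_ratio theta (X i w) - 1).

Definition mixture (p : R) (theta : Theta) (x : T) : R :=
  (1 - p) * f eta0 gamma0 x + p * f theta gamma0 x.

(* [lne] is the extended logarithm, with value -oo at 0. *)
Definition mixture_loglik (n : nat) (p : R) (theta : Theta) (w : Omega) :
    \bar R :=
  (\sum_(i < n) lne (mixture p theta (X i w))%:E)%E.

Definition null_loglik (n : nat) (w : Omega) : \bar R :=
  (\sum_(i < n) lne (f eta0 gamma0 (X i w))%:E)%E.

Definition profile_lr (n : nat) (theta : Theta) (w : Omega) : \bar R :=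
  (ereal_sup [set mixture_loglik n p theta w | p in `[0%R, 1%R]]
   - null_loglik n w)%E.

Definition lr (n : nat) (w : Omega) : \bar R :=
  (ereal_sup [set mixture_loglik n pt.1 pt.2 w
             | pt in `[0%R, 1%R] `*` [set: Theta]]
   - null_loglik n w)%E.

End statistics.

(* Main.v *)
Require Import Defs.
From mathcomp Require Import all_boot all_order all_algebra.
From mathcomp Require Import all_classical all_reals all_analysis.
From mathcomp Require Import measurable_realfun.
From mathcomp Require Import ring lra.

(** Write [r] for the density ratio at [theta], [v] for its variance under the
    null law, and [x = p (r - 1)] with the local weight [p = t / sqrt (n v)].

    If the likelihood ratio statistic is at most [M], then every mixture
    likelihood ratio is at most [exp M]; at weight [p / 2] this reads
    [prod_m (1 + x_m / 2) <= exp M], hence [prod_m (1 + x_m / 2)^2 <= exp (2 M)],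
    for every [theta] at once.  The square has a much larger mean than its
    square root: [E (1 + x / 2)^2 = 1 + t^2 / (4 n)], so that the product of [n]
    factors has mean about [exp (t^2 / 4)], which exceeds [exp (2 M)] once [t] is
    large.  If the products were concentrated around their means, this would be
    a contradiction.

    A single product is not concentrated, but averages over many values of
    [theta] are.  Since [r >= 0] and [E r = 1], the standardized score
    [(r - 1) / sqrt v] has unit norm in [L^2] while it tends to 0 in [L^1] as [v]
    grows.  It therefore becomes orthogonal to any fixed square integrable
    function ([asymptotic_orthogonality]), and one can extract [k] parameters
    whose scores are pairwise almost orthogonal
    ([eventually_pairwise_family]).  The covariance of two product statistics
    of independent observations is governed by the covariance of one factor:
    [E (u_1 u_2) <= 1 + (t^2 rho + o(1)) / n] for normalized factors gives
    [exp (t^2 rho)] for the products ([normalized_tilt_mul_exp]).  The [k]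
    normalized products thus have mean 1, bounded second moments and nearly
    vanishing covariances, and by Chebyshev's inequality they cannot all be
    below 1/2, except with small probability ([second_moment_lower_tail]).

    Second moments of [(1 + x / 2)^2] would require fourth moments of [r].  The
    factor actually used is [tilt], which is [1 + x] plus a bounded part of
    [x^2 / 4]; it still lies below [(1 + x / 2)^2] and keeps half of the gain in
    the mean, so its products grow with [t] ([tilt_mean_exp_ge]). *)

Set Implicit Arguments.
Unset Strict Implicit.
Unset Printing Implicit Defensive.
Import Order.TTheory GRing.Theory Num.Theory.
Import numFieldNormedType.Exports.

Local Open Scope classical_set_scope.
Local Open Scope ring_scope.

(** * Expectations of products of independent variables *)

Section independence.
Context {d d'} {Omega : measurableType d} {T : measurableType d'}
  {R : realType} (P : probability Omega R).
Import HBNNSimple.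

(** Both sides are linear in [g] and continuous along increasing sequences, so
    the factorization for indicators passes to nonnegative functions through
    simple functions. *)
Lemma integral_independent_factor (Y : {RV P >-> T}) (H : Omega -> R) (c : R) :
  measurable_fun setT H -> (forall w, 0 <= H w) ->
  (forall A, measurable A ->
     (\int[P]_w (\1_A (Y w) * H w)%:E = P (Y @^-1` A) * c%:E)%E) ->
  forall g : T -> R, measurable_fun setT g -> (forall x, 0 <= g x) ->
  (\int[P]_w (g (Y w) * H w)%:E = (\int[P]_w (g (Y w))%:E) * c%:E)%E.
Proof.
move=> mH H0 hA g mg g0.
have mY : measurable_fun setT Y by [].
have mgE : measurable_fun [set: T] (fun x => (g x)%:E) by exact/measurable_EFinP.
have mT : measurable [set: T] by [].
pose h := nnsfun_approx mT mgE.
have hcvg x : (EFin \o h n) x @[n --> \oo] --> (g x)%:E.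
  by apply: (cvg_nnsfun_approx mT mgE) => // y _; rewrite lee_fin.
have hnd x a b : (a <= b)%N -> h a x <= h b x.
  by move=> ab; exact/lefP/nd_nnsfun_approx.
have mhY n : measurable_fun setT (fun w => h n (Y w)).
  exact: measurableT_comp.
have L : (\int[P]_w (h n (Y w) * H w)%:E)%E @[n --> \oo] -->
    (\int[P]_w (g (Y w) * H w)%:E)%E.
  rewrite [X in _ --> X](_ : _ =
      (\int[P]_w limn (fun n => (h n (Y w) * H w)%:E))%E); last first.
    apply: eq_integral => w _; apply/esym/cvg_lim => //.
    rewrite EFinM; under eq_fun do rewrite EFinM.
    by apply: cvgeZr => //; exact: hcvg.
  apply: cvg_monotone_convergence => //.
  - by move=> n; apply/measurable_EFinP; exact: measurable_funM.
  - by move=> n w _; rewrite lee_fin mulr_ge0.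
  - by move=> w _ a b ab; rewrite lee_fin ler_wpM2r// hnd.
have L' : (\int[P]_w (h n (Y w))%:E)%E @[n --> \oo] -->
    (\int[P]_w (g (Y w))%:E)%E.
  rewrite [X in _ --> X](_ : _ =
      (\int[P]_w limn (fun n => (h n (Y w))%:E))%E); last first.
    by apply: eq_integral => w _; apply/esym/cvg_lim => //; exact: hcvg.
  apply: cvg_monotone_convergence => //.
  - by move=> n; apply/measurable_EFinP.
  - by move=> n w _; rewrite lee_fin.
  - by move=> w _ a b ab; rewrite lee_fin hnd.
suff suf n : (\int[P]_w (h n (Y w) * H w)%:E =
    (\int[P]_w (h n (Y w))%:E) * c%:E)%E.
  rewrite -(cvg_lim _ L)//; apply/cvg_lim => //.
  by under eq_fun do rewrite suf; apply: cvgeZr.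
have mpre y : measurable (h n @^-1` [set y]) by [].
have m1 y : measurable_fun setT (fun w => \1_(h n @^-1` [set y]) (Y w) : R).
  by apply: (measurableT_comp _ mY); exact: measurable_indic.
have y0 (y : R) : y \in range (h n) -> 0 <= y.
  by rewrite inE => -[x _ <-].
have pos y w : 0 <= y * \1_(h n @^-1` [set y]) (Y w).
  by rewrite -lee_fin; exact: nnfun_muleindic_ge0.
transitivity (\int[P]_w (\sum_(y \in range (h n))
    (y * \1_(h n @^-1` [set y]) (Y w) * H w)%:E))%E.
  apply: eq_integral => w _.
  rewrite [in LHS]fimfunE EFinM -fsumEFin// ge0_mule_fsuml//.
    by move=> y; rewrite lee_fin.
rewrite ge0_integral_fsum//; last 2 first.
  - by move=> y; apply/measurable_EFinP; do 2 apply: measurable_funM => //.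
  - by move=> y w _; rewrite lee_fin mulr_ge0.
transitivity ((\int[P]_w (\sum_(y \in range (h n))
    (y * \1_(h n @^-1` [set y]) (Y w))%:E)) * c%:E)%E; last first.
  congr (_ * _)%E; apply: eq_integral => w _.
  by rewrite [in RHS]fimfunE -fsumEFin.
rewrite ge0_integral_fsum//; last 2 first.
  - by move=> y; apply/measurable_EFinP; apply: measurable_funM => //.
  - by move=> y w _; rewrite lee_fin.
rewrite ge0_mule_fsuml; last by move=> y; apply: integral_ge0 => w _; rewrite lee_fin.
apply: eq_fsbigr => y /y0 yge0.
under eq_integral do rewrite -mulrA EFinM.
rewrite ge0_integralZl//; last 2 first.
  - by apply/measurable_EFinP; apply: measurable_funM.
  - by move=> w _; rewrite lee_fin mulr_ge0.
rewrite hA// muleA; congr (_ * _)%E.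
under eq_integral do rewrite EFinM.
rewrite ge0_integralZl//; last first.
  exact/measurable_EFinP.
congr (_ * _)%E.
rewrite -(setIT (Y @^-1` _)) -integral_indic//.
by rewrite -[X in measurable X]setTI; exact: mY.
Qed.

Lemma prod_indic (X : nat -> Omega -> T) (A : nat -> set T) (s : seq nat) w :
  \prod_(i <- s) (\1_(A i) (X i w) : R) =
  \1_(\bigcap_(i in [set` s]) X i @^-1` A i) w.
Proof.
elim: s => [|a s IH].
  by rewrite big_nil indicE mem_set// => i; rewrite /= in_nil.
rewrite big_cons IH !indicE -natrM mulnb; congr (_%:R); congr nat_of_bool.
apply/andP/idP => [[/set_mem Aa /set_mem As]|/set_mem h].
  apply/mem_set => i; rewrite /= inE => /orP[/eqP->//|is_]; exact: As.
split; apply/mem_set; first by apply: h; rewrite /= mem_head.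
by move=> i is_; apply: h; rewrite /= inE is_ orbT.
Qed.

(** Independence gives the formula when all [g i] are indicators.  The
    indicators are then exchanged for general functions one index at a time,
    which is why the claim proved by induction has a block [s1] of general
    factors and a block [s2] of indicators. *)
Lemma integral_prod_independent (X : nat -> {RV P >-> T})
    (X_indep : mutually_independent X) (g : nat -> T -> R) (e : nat -> R) :
  (forall i, measurable_fun setT (g i)) -> (forall i x, 0 <= g i x) ->
  (forall i, (\int[P]_w (g i (X i w))%:E = (e i)%:E)%E) ->
  forall s, uniq s ->
  (\int[P]_w (\prod_(i <- s) g i (X i w))%:E = (\prod_(i <- s) e i)%:E)%E.
Proof.
move=> mg g0 ge.
suff gen s1 : forall s2 (A : nat -> set T), uniq (s1 ++ s2) ->
    (forall i, measurable (A i)) ->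
    (\int[P]_w (\prod_(i <- s1) g i (X i w) *
               \prod_(i <- s2) \1_(A i) (X i w))%:E =
     (\prod_(i <- s1) e i * \prod_(i <- s2) fine (P (X i @^-1` A i)))%:E)%E.
  move=> s us; have := gen s [::] (fun=> setT).
  rewrite cats0 big_nil mulr1 => <- //.
  by apply: eq_integral => w _; rewrite big_nil mulr1.
have mX i A : measurable A -> measurable (X i @^-1` A).
  by move=> mA; rewrite -[X in measurable X]setTI; apply: measurable_funP.
elim: s1 => [|a s1 IH] s2 A us mA.
  under eq_integral do rewrite big_nil mul1r (prod_indic (fun i => X i : Omega -> T)).
  rewrite integral_indic//; last by apply: bigcap_measurableType => // i _; exact: mX.
  rewrite setIT [LHS](X_indep s2 A us mA) big_nil mul1r -prodEFin.
  by apply: eq_bigr => i _; rewrite fineK// fin_num_measure//; exact: mX.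
under eq_integral do rewrite big_cons -mulrA.
rewrite (@integral_independent_factor (X a) _
  (\prod_(i <- s1) e i * \prod_(i <- s2) fine (P (X i @^-1` A i)))).
- by rewrite ge big_cons -EFinM mulrA.
- apply: measurable_funM; apply: measurable_prod => i _.
    by apply: measurableT_comp => //; exact: mg.
  by apply: (@measurableT_comp _ _ _ _ _ _ (\1_(A i) : T -> R)) => //;
    exact: measurable_indic.
- by move=> w; apply: mulr_ge0; apply: prodr_ge0 => i _.
- move=> B mB.
  (* The indicator of [B] at index [a] joins the block of indicators. *)
  pose A' i := if i == a then B else A i.
  have mA' i : measurable (A' i) by rewrite /A'; case: ifP.
  have nas2 : a \notin s2.
    by move: us => /= /andP[]; rewrite mem_cat negb_or => /andP[].
  have A'E i : i \in s2 -> A' i = A i.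
    by move=> is2; rewrite /A'; case: eqP => // iE; rewrite -iE is2 in nas2.
  have := IH (a :: s2) A'.
  rewrite (perm_uniq (_ : perm_eq _ ((a :: s1) ++ s2))); last first.
    by rewrite /= -(cat1s a s2) -(cat1s a (s1 ++ s2)) perm_catCA.
  move=> /(_ us mA'); rewrite big_cons /A' eqxx -/(A') => E.
  transitivity (\int[P]_w (\prod_(i <- s1) g i (X i w) *
      \prod_(i <- a :: s2) \1_(A' i) (X i w))%:E)%E.
    apply: eq_integral => w _; rewrite big_cons /A' eqxx mulrCA.
    congr EFin; congr (_ * (_ * _)).
    by apply: eq_big_seq => i /A'E; rewrite /A' => ->.
  rewrite E -[X in (X * _)%E]fineK; last by rewrite fin_num_measure//; exact: mX.
  rewrite -EFinM mulrCA; congr EFin; congr (_ * (_ * _)).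
  by apply: eq_big_seq => i /A'E; rewrite /A' => ->.
- exact: mg.
- exact: g0.
Qed.
End independence.

(** * A second moment bound *)

Section second_moment.
Context {d} {Omega : measurableType d} {R : realType}
  (P : probability Omega R).

(** If every [G i] is at most 1/2, the sum [Z] of the [G i] is below its mean
    [k] by at least [k / 2], while the variance of [Z] is at most
    [k C + k^2 delta]. *)
Lemma second_moment_lower_tail (k : nat) (G : nat -> Omega -> R) (C delta : R) :
  (0 < k)%N ->
  (forall i, measurable_fun setT (G i)) -> (forall i w, 0 <= G i w) ->
  (forall i, (i < k)%N -> (\int[P]_w (G i w)%:E = 1)%E) ->
  (forall i, (i < k)%N -> (\int[P]_w (G i w * G i w)%:E <= C%:E)%E) ->
  (forall i j, (i < k)%N -> (j < k)%N -> i != j ->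
     (\int[P]_w (G i w * G j w)%:E <= (1 + delta)%:E)%E) ->
  0 <= delta ->
  (P (\bigcap_(i in `I_k) [set w | (G i w <= 2^-1)%R])
     <= (4 * (C / k%:R + delta))%:E)%E.
Proof.
move=> k0 mG G0 G1 GC Gd d0.
set A := (X in P X).
have kR : (0 : R) < k%:R by rewrite ltr0n.
have mA : measurable A.
  apply: bigcap_measurableType => // i _.
  rewrite (_ : [set w | _] = G i @^-1` `]-oo, 2^-1]%classic); last first.
    by apply/seteqP; split => w /=; rewrite in_itv.
  by rewrite -[X in measurable X]setTI; apply: mG.
pose Z w := \sum_(i < k) G i w.
have mZ : measurable_fun setT Z by apply: measurable_sum.
have Z0 w : 0 <= Z w by apply: sumr_ge0.
have iZ : (\int[P]_w (Z w)%:E = k%:R%:E)%E.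
  under eq_integral do rewrite -sumEFin.
  rewrite ge0_integral_sum//; last 2 first.
  - by move=> i; exact/measurable_EFinP.
  - by move=> i w _; rewrite lee_fin.
  under eq_bigr => i _ do rewrite G1//.
  by rewrite sumEFin big_const_ord iter_addr addr0.
have iZ2 : (\int[P]_w (Z w ^+ 2)%:E <= (k%:R * C + k%:R ^+ 2 * (1 + delta))%:E)%E.
  have -> : (\int[P]_w (Z w ^+ 2)%:E =
      \sum_(i < k) \sum_(j < k) \int[P]_w (G i w * G j w)%:E)%E.
    transitivity (\int[P]_w (\sum_(i < k) \sum_(j < k) (G i w * G j w)%:E))%E.
      apply: eq_integral => w _; rewrite expr2 /Z mulr_suml -sumEFin.
      by apply: eq_bigr => i _; rewrite mulr_sumr -sumEFin.
    rewrite ge0_integral_sum//; last 2 first.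
    - move=> i; apply: emeasurable_sum => j.
      by apply/measurable_EFinP; exact: measurable_funM.
    - by move=> i w _; apply: sume_ge0 => j _; rewrite lee_fin mulr_ge0.
    apply: eq_bigr => i _; rewrite ge0_integral_sum//.
    - by move=> j; apply/measurable_EFinP; exact: measurable_funM.
    - by move=> j w _; rewrite lee_fin mulr_ge0.
  apply: (@le_trans _ _
    (\sum_(i < k) \sum_(j < k) ((i == j)%:R * C + (1 + delta))%:E)%E).
    apply: lee_sum => i _; apply: lee_sum => j _.
    have [<-|ij] := eqVneq i j.
      apply: (le_trans (GC i (ltn_ord i))); rewrite lee_fin mul1r lerDl.
      by rewrite addr_ge0.
    by rewrite mul0r add0r Gd.
  under eq_bigr do rewrite sumEFin big_split/= -mulr_suml.
  rewrite sumEFin big_split/= lee_fin -mulr_suml lerD//.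
    rewrite (_ : \sum_(i < k) _ = k%:R :> R)//.
    rewrite (eq_bigr (fun=> 1)) ?sumr_const ?card_ord// => i _.
    rewrite (bigD1 i)//= eqxx big1 ?addr0// => j.
    by rewrite eq_sym => /negbTE ->.
  by rewrite !sumr_const !card_ord -mulrnA -[_ *+ _]mulr_natl natrM expr2.
(* [(Z - k)^2] expanded, with every term on the side where it is nonnegative. *)
have key : (\int[P]_w ((Z w - k%:R) ^+ 2)%:E + (2 * k%:R ^+ 2)%:E =
    \int[P]_w (Z w ^+ 2)%:E + (k%:R ^+ 2)%:E)%E.
  have mZk : measurable_fun setT (fun w => (Z w - k%:R) ^+ 2).
    by apply: measurable_funX; apply: measurable_funB.
  have m1 : measurable_fun setT (fun w => ((Z w - k%:R) ^+ 2)%:E).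
    exact/measurable_EFinP.
  have m2 : measurable_fun setT (fun w => (2 * k%:R * Z w)%:E).
    by apply/measurable_EFinP; apply: measurable_funM.
  have m3 : measurable_fun setT (fun w => (Z w ^+ 2)%:E).
    by apply/measurable_EFinP; exact: measurable_funX.
  have n1 w : [set: Omega] w -> (0 <= ((Z w - k%:R) ^+ 2)%:E)%E.
    by rewrite lee_fin sqr_ge0.
  have n2 w : [set: Omega] w -> (0 <= (2 * k%:R * Z w)%:E)%E.
    by rewrite lee_fin !mulr_ge0.
  have n3 w : [set: Omega] w -> (0 <= (Z w ^+ 2)%:E)%E.
    by rewrite lee_fin sqr_ge0.
  have n4 w : [set: Omega] w -> (0 <= (k%:R ^+ 2 : R)%:E)%E.
    by rewrite lee_fin sqr_ge0.
  have -> : ((2 * k%:R ^+ 2)%:E = \int[P]_w (2 * k%:R * Z w)%:E)%E.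
    under eq_integral do rewrite EFinM.
    have mZE : measurable_fun setT (fun w => (Z w)%:E) by exact/measurable_EFinP.
    have nZ w : [set: Omega] w -> (0 <= (Z w)%:E)%E by rewrite lee_fin.
    have nk : (0 <= (2 * k%:R : R)%:E)%E by rewrite lee_fin mulr_ge0.
    rewrite ge0_integralZl//.
    by rewrite iZ -EFinM expr2 mulrA.
  have -> : ((k%:R ^+ 2)%:E = \int[P]_w (k%:R ^+ 2)%:E)%E.
    by rewrite integral_cst// [X in (_ * X)%E](probability_setT P) mule1.
  rewrite -!ge0_integralD//.
  by apply: eq_integral => w _; rewrite -!EFinD; congr EFin; ring.
have var : (\int[P]_w ((Z w - k%:R) ^+ 2)%:E <= (k%:R * C + k%:R ^+ 2 * delta)%:E)%E.
  rewrite -(@leeD2rE _ (2 * k%:R ^+ 2)%:E)// key.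
  apply: (le_trans (leeD2r _ iZ2)).
  by rewrite -!EFinD lee_fin; lra.
have lb : (P A * (k%:R ^+ 2 / 4)%:E <= \int[P]_w ((Z w - k%:R) ^+ 2)%:E)%E.
  have m1 : measurable_fun setT (fun w => (\1_A w : R)%:E).
    by apply/measurable_EFinP; exact: measurable_indic.
  have n1 w : [set: Omega] w -> (0 <= (\1_A w : R)%:E)%E by rewrite lee_fin.
  have n2 : 0 <= (k%:R ^+ 2 / 4 : R) by rewrite divr_ge0// sqr_ge0.
  rewrite -{1}(setIT A) -integral_indic// -ge0_integralZr//.
  apply: ge0_le_integral => //.
  - by apply: emeasurable_funM.
  - by apply/measurable_EFinP; apply: measurable_funX; exact: measurable_funB.
  move=> w _; rewrite -EFinM lee_fin indicE.
  have [/set_mem Aw|_] := boolP (w \in A); last by rewrite mul0r sqr_ge0.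
  have Zle : Z w <= k%:R * 2^-1.
    rewrite mulr_natl -[X in _ <= _ *+ X](card_ord k) -sumr_const.
    by apply: ler_sum => i _; exact: Aw (ltn_ord i).
  rewrite mul1r -[X in _ <= X]sqrrN opprB.
  have -> : k%:R ^+ 2 / 4 = (k%:R / 2) ^+ 2 :> R by field.
  by rewrite lerXn2r ?nnegrE ?divr_ge0//; lra.
have := le_trans lb var; rewrite -lee_pdivlMr ?divr_gt0 ?exprn_gt0// => /le_trans; apply.
rewrite -EFinM lee_fin le_eqVlt; apply/orP; left; apply/eqP.
field; lra.
Qed.
End second_moment.

(** * Tilted factors *)

Section tilt.
Context {d} {T : measurableType d} {R : realType} (L : probability T R).

Let itg (f : T -> R) := L.-integrable setT (EFin \o f).

Lemma integrable_lin (a b : R) (f g : T -> R) : itg f -> itg g ->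
  itg (fun x => a * f x + b * g x).
Proof.
move=> If Ig.
have := integrableD measurableT (integrableZl measurableT a If)
  (integrableZl measurableT b Ig).
by [].
Qed.

Lemma Rintegral_lin (a b : R) (f g : T -> R) : itg f -> itg g ->
  \int[L]_x (a * f x + b * g x) = a * \int[L]_x f x + b * \int[L]_x g x.
Proof.
move=> If Ig; rewrite RintegralD//; last 2 first.
- exact: (integrableZl measurableT a If).
- exact: (integrableZl measurableT b Ig).
by rewrite !RintegralZl.
Qed.

Lemma integrable_cst (a : R) : itg (cst a).
Proof. exact: finite_measure_integrable_cst. Qed.

Lemma Rintegral_cst_probability (a : R) : \int[L]_x a = a.
Proof. by rewrite Rintegral_cst// [X in fine X](probability_setT L) mulr1. Qed.

Lemma integrable_dominated (f g : T -> R) : measurable_fun setT f ->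
  (forall x, `|f x| <= g x) -> itg g -> itg f.
Proof.
move=> mf fg; apply: le_integrable => //; first exact/measurable_EFinP.
by move=> x _; rewrite lee_fin (le_trans (fg x))// ler_norm.
Qed.

Lemma Rintegral_min_approx (h : T -> R) (tau : R) :
  measurable_fun setT h -> (forall x, 0 <= h x) -> itg h -> 0 < tau ->
  exists K : R, 0 < K /\ \int[L]_x h x - tau < \int[L]_x Num.min (h x) K.
Proof.
move=> mh h0 Ih tau0.
pose m n x := Num.min (h x) n%:R.
have mm n : measurable_fun setT (m n) by apply: measurable_minr.
have m0 n x : 0 <= m n x by rewrite le_min h0 ler0n.
have mle n x : m n x <= h x by rewrite ge_min lexx.
have Im n : itg (m n).
  by apply: (integrable_dominated (mm n) _ Ih) => x; rewrite ger0_norm.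
have cv : (\int[L]_x (m n x)%:E)%E @[n --> \oo] --> (\int[L]_x (h x)%:E)%E.
  rewrite [X in _ --> X](_ : _ =
      (\int[L]_x limn (fun n => (m n x)%:E))%E); last first.
    apply: eq_integral => x _; apply/esym/cvg_lim => //.
    apply: cvg_near_cst; exists (Num.truncn (h x)).+1 => // n /= hn.
    rewrite /m min_l//; apply: ltW; apply: (lt_le_trans (truncnS_gt _)).
    by rewrite ler_nat.
  apply: cvg_monotone_convergence => //.
  - by move=> n; exact/measurable_EFinP.
  - by move=> n x _; rewrite lee_fin.
  - move=> x _ a b ab; rewrite lee_fin le_min ge_min lexx/= ge_min ler_nat ab.
    by rewrite orbT.
have fin : (\int[L]_x (h x)%:E)%E \is a fin_num by exact: integrable_fin_num.
have /fine_cvg cv' : (\int[L]_x (m n x)%:E)%E @[n --> \oo] -->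
   (fine (\int[L]_x (h x)%:E))%:E by rewrite fineK.
have := cvgr_gt _ cv' (\int[L]_x h x - tau); rewrite ltrBlDr ltrDl => /(_ _ tau0).
case=> N _ /(_ N.+1) /= => /(_ (leqnSn _)) H.
by exists N.+1%:R; split.
Qed.

(** A substitute for [(1 + p (r - 1) / 2) ^ 2] with finite second moment: the
    cutoff [b] stands for a bounded part of [(r - 1) ^ 2]. *)
Definition tilt (r b : T -> R) (p : R) (x : T) : R :=
  1 + p * (r x - 1) + p ^+ 2 / 4 * b x.

Lemma measurable_tilt r b p : measurable_fun setT r -> measurable_fun setT b ->
  measurable_fun setT (tilt r b p).
Proof.
move=> mr mb; apply: measurable_funD; last exact: measurable_funM.
by apply: measurable_funD => //; apply: measurable_funM => //;
  exact: measurable_funB.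
Qed.

Lemma tilt_ge0 r b p : (forall x, 0 <= r x) -> (forall x, 0 <= b x) ->
  0 <= p <= 1 -> forall x, 0 <= tilt r b p x.
Proof.
move=> r0 b0 /andP[p0 p1] x; rewrite /tilt.
have := mulr_ge0 p0 (r0 x).
have : 0 <= p ^+ 2 / 4 * b x by rewrite mulr_ge0// divr_ge0// sqr_ge0.
lra.
Qed.

Lemma tilt_le_sqr r b p x : b x <= (r x - 1) ^+ 2 ->
  tilt r b p x <= (1 + p / 2 * (r x - 1)) ^+ 2.
Proof.
move=> brx; rewrite /tilt.
have : 0 <= p ^+ 2 / 4 * ((r x - 1) ^+ 2 - b x).
  by rewrite mulr_ge0 ?subr_ge0// divr_ge0// sqr_ge0.
lra.
Qed.

Lemma integrable_tilt r b p : itg r -> itg b -> itg (tilt r b p).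
Proof.
move=> Ir Ib.
have -> : tilt r b p = (fun x => p * r x + 1 * (p ^+ 2 / 4 * b x + (1 - p) * cst 1 x)).
  by apply/funext => x; rewrite /tilt /=; ring.
apply: integrable_lin => //; apply: integrable_lin => //; exact: integrable_cst.
Qed.

Lemma Rintegral_tilt r b p : itg r -> itg b -> \int[L]_x r x = 1 ->
  \int[L]_x tilt r b p x = 1 + p ^+ 2 / 4 * \int[L]_x b x.
Proof.
move=> Ir Ib r1.
have -> : tilt r b p = (fun x => p * r x + 1 * (p ^+ 2 / 4 * b x + (1 - p) * cst 1 x)).
  by apply/funext => x; rewrite /tilt /=; ring.
rewrite !Rintegral_lin ?r1 ?Rintegral_cst_probability//; first by ring.
- exact: integrable_cst.
- by apply: integrable_lin => //; exact: integrable_cst.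
Qed.

(** Up to terms of third order in the weights, the covariance of two tilted
    factors is that of the parts [p1 (r1 - 1)] and [p2 (r2 - 1)].  The cutoffs
    are bounded by [K] where they multiply another random term, so only
    products [r1 r2] remain to be integrated. *)
Lemma Rintegral_tilt_mul (r1 r2 b1 b2 : T -> R) (p1 p2 K c : R) :
  measurable_fun setT r1 -> measurable_fun setT r2 ->
  measurable_fun setT b1 -> measurable_fun setT b2 ->
  (forall x, 0 <= r1 x) -> (forall x, 0 <= r2 x) ->
  (forall x, 0 <= b1 x <= K) -> (forall x, 0 <= b2 x <= K) ->
  itg r1 -> itg r2 -> itg (fun x => r1 x * r2 x) -> itg b1 -> itg b2 ->
  \int[L]_x r1 x = 1 -> \int[L]_x r2 x = 1 ->
  \int[L]_x (r1 x * r2 x) <= 1 + c ->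
  0 <= p1 <= 1 -> 0 <= p2 <= 1 ->
  itg (fun x => tilt r1 b1 p1 x * tilt r2 b2 p2 x) /\
  \int[L]_x (tilt r1 b1 p1 x * tilt r2 b2 p2 x) <=
  (\int[L]_x tilt r1 b1 p1 x) * (\int[L]_x tilt r2 b2 p2 x) +
  (p1 * p2 * c + (p2 ^+ 2 * p1 + p1 ^+ 2 * p2) / 4 * K +
   p1 ^+ 2 * p2 ^+ 2 / 16 * K ^+ 2).
Proof.
move=> mr1 mr2 mb1 mb2 r10 r20 b1K b2K I1 I2 I12 Ib1 Ib2 E1 E2 E12 p1P p2P.
have /andP[p10 p11] := p1P; have /andP[p20 p21] := p2P.
pose q1 := p1 ^+ 2 / 4; pose q2 := p2 ^+ 2 / 4.
have q10 : 0 <= q1 by rewrite divr_ge0// sqr_ge0.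
have q20 : 0 <= q2 by rewrite divr_ge0// sqr_ge0.
have b10 x : 0 <= b1 x by have /andP[] := b1K x.
have b20 x : 0 <= b2 x by have /andP[] := b2K x.
pose c0 := (1 - p1) * (1 - p2) + q1 * q2 * K ^+ 2.
pose c1 := p1 * (1 - p2) + q2 * p1 * K.
pose c2 := (1 - p1) * p2 + q1 * p2 * K.
(* The product after bounding the cutoffs by [K] in every mixed term. *)
pose g x := c1 * r1 x + 1 * (c2 * r2 x + 1 * (p1 * p2 * (r1 x * r2 x) +
  1 * (q1 * b1 x + 1 * (q2 * b2 x + c0 * cst 1 x)))).
have Ig0 : itg (cst 1) := integrable_cst 1.
have Ig1 := integrable_lin q2 c0 Ib2 Ig0.
have Ig2 := integrable_lin q1 1 Ib1 Ig1.
have Ig3 := integrable_lin (p1 * p2) 1 I12 Ig2.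
have Ig4 := integrable_lin c2 1 I2 Ig3.
have Ig : itg g := integrable_lin c1 1 I1 Ig4.
have Eg : \int[L]_x g x <= 1 + p1 ^+ 2 / 4 * \int[L]_x b1 x
    + p2 ^+ 2 / 4 * \int[L]_x b2 x + (p1 * p2 * c +
   (p2 ^+ 2 * p1 + p1 ^+ 2 * p2) / 4 * K + p1 ^+ 2 * p2 ^+ 2 / 16 * K ^+ 2).
  rewrite /g !Rintegral_lin// Rintegral_cst_probability E1 E2.
  have := ler_wpM2l (mulr_ge0 p10 p20) E12.
  rewrite /c0 /c1 /c2 /q1 /q2; lra.
have tg x : tilt r1 b1 p1 x * tilt r2 b2 p2 x <= g x.
  rewrite /tilt /g /= -/q1 -/q2 -subr_ge0.
  have /andP[_ h1] := b1K x; have /andP[_ h2] := b2K x.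
  have bb : b1 x * b2 x <= K ^+ 2 by rewrite expr2 ler_pM.
  have -> : c1 * r1 x + 1 * (c2 * r2 x + 1 * (p1 * p2 * (r1 x * r2 x) +
      1 * (q1 * b1 x + 1 * (q2 * b2 x + c0 * 1)))) -
    (1 + p1 * (r1 x - 1) + q1 * b1 x) * (1 + p2 * (r2 x - 1) + q2 * b2 x) =
    q2 * p1 * r1 x * (K - b2 x) + q1 * p2 * r2 x * (K - b1 x) +
    q1 * q2 * (K ^+ 2 - b1 x * b2 x) + q2 * p1 * b2 x + q1 * p2 * b1 x.
    by rewrite /c0 /c1 /c2; ring.
  by rewrite !addr_ge0// !mulr_ge0// subr_ge0.
have t10 := tilt_ge0 r10 b10 p1P; have t20 := tilt_ge0 r20 b20 p2P.
have It : itg (fun x => tilt r1 b1 p1 x * tilt r2 b2 p2 x).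
  apply: (integrable_dominated _ _ Ig) => [|x].
    by apply: measurable_funM; exact: measurable_tilt.
  by rewrite ger0_norm ?mulr_ge0.
split=> //; apply: (le_trans (le_Rintegral measurableT It Ig (fun x _ => tg x))).
apply: (le_trans Eg); rewrite lerD2r !Rintegral_tilt//.
have B10 : 0 <= \int[L]_x b1 x by apply: Rintegral_ge0.
have B20 : 0 <= \int[L]_x b2 x by apply: Rintegral_ge0.
have := mulr_ge0 (mulr_ge0 q10 B10) (mulr_ge0 q20 B20).
rewrite /q1 /q2; lra.
Qed.

End tilt.

(** * Asymptotic orthogonality of density ratios *)

Section tiltable.
Context {d} {T : measurableType d} {R : realType} (L : probability T R).

Let itg (f : T -> R) := L.-integrable setT (EFin \o f).

(** The lower bound on the variance makes the local weight of a ratio at most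
    [t / sqrt n], uniformly over the ratios. *)
Record unit_mean_ratio (r : T -> R) (v : R) : Prop := UnitMeanRatio {
  ratio_measurable : measurable_fun setT r;
  ratio_ge0 : forall x, 0 <= r x;
  ratio_sqr_integrable : itg (fun x => r x ^+ 2);
  ratio_mean1 : \int[L]_x r x = 1;
  ratio_second_moment : \int[L]_x (r x ^+ 2) = 1 + v;
  ratio_var_ge1 : 1 <= v
}.

Record square_cutoff (r b : T -> R) (v K : R) : Prop := SquareCutoff {
  cutoff_measurable : measurable_fun setT b;
  cutoff_bounded : forall x, 0 <= b x <= K;
  cutoff_le_sqr : forall x, b x <= (r x - 1) ^+ 2;
  cutoff_mean : v / 2 <= \int[L]_x b x
}.

Lemma ratio_integrable r v : unit_mean_ratio r v -> itg r.
Proof.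
case=> mr r0 I2 _ _ _.
apply: (@integrable_dominated _ _ _ L r (fun x => 1 * cst 1 x + 1 * (r x ^+ 2))) => //.
  by move=> x; rewrite ger0_norm//= !mul1r; have := sqr_ge0 (r x - 1); nra.
by apply: integrable_lin => //; exact: integrable_cst.
Qed.

Lemma ratio_mul_integrable r1 r2 v1 v2 :
  unit_mean_ratio r1 v1 -> unit_mean_ratio r2 v2 ->
  itg (fun x => r1 x * r2 x).
Proof.
case=> mr r0 I2 _ _ _ [mr' r0' I2' _ _ _].
apply: (@integrable_dominated _ _ _ L _
    (fun x => 1 * (r1 x ^+ 2) + 1 * (r2 x ^+ 2))).
- exact: measurable_funM.
- move=> x; rewrite ger0_norm ?mulr_ge0// !mul1r.
  by have := sqr_ge0 (r1 x - r2 x); have := sqr_ge0 (r1 x + r2 x); nra.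
- exact: integrable_lin.
Qed.

Lemma cutoff_integrable r b v K : square_cutoff r b v K -> itg b.
Proof.
case=> mb bK _ _; apply: (@integrable_dominated _ _ _ L _ (cst K)) => //.
  by move=> x; have /andP[b0 ?] := bK x; rewrite ger0_norm.
exact: integrable_cst.
Qed.

Lemma square_cutoff_exists r v : unit_mean_ratio r v ->
  exists b K, square_cutoff r b v K.
Proof.
move=> rv; have Ir := ratio_integrable rv.
case: rv => mr r0 I2 E1 E2 v1.
pose h x := (r x - 1) ^+ 2.
have mh : measurable_fun setT h.
  by apply: measurable_funX; exact: measurable_funB.
have hE : h = (fun x => 1 * (r x ^+ 2) + 1 * (- 2 * r x + 1 * cst 1 x)).
  by apply/funext => x; rewrite /h /=; ring.
have I1 : itg (cst 1) by exact: integrable_cst.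
have Ih : itg h by rewrite hE; do 2 apply: integrable_lin => //.
have Eh : \int[L]_x h x = v.
  rewrite hE !Rintegral_lin// ?E1 ?E2 ?Rintegral_cst_probability; first by ring.
  exact: integrable_lin.
have v20 : 0 < v / 2 by lra.
have [K [K0 HK]] := Rintegral_min_approx mh (fun x => sqr_ge0 _) Ih v20.
exists (fun x => Num.min (h x) K), K; split.
- exact: measurable_minr.
- by move=> x; rewrite le_min sqr_ge0 (ltW K0)/= ge_min lexx orbT.
- by move=> x; rewrite ge_min lexx.
- by move: HK; rewrite Eh; lra.
Qed.

(** Where [r] is bounded by [k], the product [r r'] has mean at most [k] because
    [r'] has mean 1, and [k] is negligible with respect to [sqrt v'].  The excess
    of [r] over [k] is small in [L^2], and is paired with [r'] by the inequality
    between arithmetic and geometric means at scale [s]. *)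
Lemma asymptotic_orthogonality r v (e : R) : unit_mean_ratio r v -> 0 < e ->
  exists V : R, forall r' v', unit_mean_ratio r' v' -> V <= v' ->
    \int[L]_x (r x * r' x) <= 1 + e * (Num.sqrt v * Num.sqrt v').
Proof.
move=> rv e0; have [mr r0 I2 _ _ v1] := rv.
have mr2 : measurable_fun setT (fun x => r x ^+ 2) by exact: measurable_funX.
have tau0 : 0 < e ^+ 2 / 8 by rewrite divr_gt0// exprn_gt0.
have [K [K0 HK]] := Rintegral_min_approx mr2 (fun x => sqr_ge0 _) I2 tau0.
pose m x := Num.min (r x ^+ 2) K.
have Im : itg m.
  apply: (integrable_dominated _ _ I2); first exact: measurable_minr.
  move=> x; rewrite ger0_norm /m ?ge_min ?lexx//.
  by rewrite le_min sqr_ge0 ltW.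
pose k := Num.sqrt K.
have k0 : 0 <= k by exact: sqrtr_ge0.
have kK : k ^+ 2 = K by rewrite sqr_sqrtr// ltW.
exists ((2 * k / e) ^+ 2) => r' v' rv' Vv'.
have I' := ratio_integrable rv'.
have I12 := ratio_mul_integrable rv rv'.
case: rv' => mr' r0' I2' E1' E2' v1'.
pose w := Num.sqrt v'.
have w2 : w ^+ 2 = v' by rewrite sqr_sqrtr//; lra.
have w1 : 1 <= w by rewrite -sqrtr1 ler_sqrt//; lra.
have kw : k <= e / 2 * w.
  have k20 : 0 <= 2 * k / e by rewrite divr_ge0 ?mulr_ge0// ltW.
  have : 2 * k / e <= w.
    by rewrite -(@ler_pXn2r _ 2) ?nnegrE ?w2//; lra.
  rewrite ler_pdivrMr//; lra.
(* The part of [r] above [k] has squared norm at most [e^2 / 8], and [r'] has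
   squared norm [1 + v' <= 2 w^2]; this [s] makes both halves of the bound at
   most [e w / 4]. *)
pose s := 4 / e * w.
have s0 : 0 < s by rewrite mulr_gt0 ?divr_gt0//; lra.
pose g x := k * r' x + 1 * (s / 2 * (1 * (r x ^+ 2) + -1 * m x) +
    (s^-1 / 2) * (r' x ^+ 2)).
have Ia : itg (fun x => 1 * (r x ^+ 2) + -1 * m x) by exact: integrable_lin.
have Ib : itg (fun x => s / 2 * (1 * (r x ^+ 2) + -1 * m x) +
    (s^-1 / 2) * (r' x ^+ 2)) by exact: integrable_lin.
have Ig : itg g by exact: integrable_lin.
have le_g x : r x * r' x <= g x.
  have amgm a : 0 <= a -> a * r' x <= s / 2 * a ^+ 2 + s^-1 / 2 * r' x ^+ 2.
    move=> a0; rewrite -subr_ge0.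
    have -> : s / 2 * a ^+ 2 + s^-1 / 2 * r' x ^+ 2 - a * r' x =
       s^-1 / 2 * (s * a - r' x) ^+ 2 by field; lra.
    by rewrite mulr_ge0 ?sqr_ge0// divr_ge0// invr_ge0 ltW.
  rewrite /g mul1r; have [rk|kr] := leP (r x) k.
    rewrite -[X in X <= _]addr0 lerD// ?ler_wpM2r// addr_ge0//.
      rewrite mulr_ge0 ?divr_ge0 ?(ltW s0)// mul1r mulN1r subr_ge0.
      by rewrite /m ge_min lexx.
    by rewrite mulr_ge0 ?sqr_ge0// divr_ge0// invr_ge0 ltW.
  (* Above [k], [(r - k)^2 <= r^2 - k^2], and [k^2 = min(r^2, K)]. *)
  have -> : m x = k ^+ 2.
    rewrite /m kK min_r// -kK; apply: ltW.
    by rewrite ltrXn2r ?nnegrE// (le_trans k0)// ltW.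
  have rk0 : 0 <= r x - k by lra.
  have /amgm := rk0.
  have : s / 2 * (r x - k) ^+ 2 <= s / 2 * (1 * r x ^+ 2 + -1 * k ^+ 2).
    by rewrite ler_pM2l ?divr_gt0//; nra.
  lra.
apply: (le_trans (le_Rintegral measurableT I12 Ig (fun x _ => le_g x))).
rewrite /g !Rintegral_lin// E1' E2'.
have wv : 1 <= Num.sqrt v by rewrite -sqrtr1 ler_sqrt//; lra.
have h1 : e * w <= e * (Num.sqrt v * w) by rewrite ler_pM2l// ler_peMl//; lra.
have h2 : s / 2 * (1 * \int[L]_x (r x ^+ 2) + -1 * \int[L]_x m x) <= e / 4 * w.
  apply: (@le_trans _ _ (s / 2 * (e ^+ 2 / 8))).
    by rewrite ler_pM2l ?divr_gt0//; move: HK; rewrite -/m; lra.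
  by rewrite /s le_eqVlt; apply/orP; left; apply/eqP; field; lra.
have h3 : s^-1 / 2 * (1 + v') <= e / 4 * w.
  rewrite -w2 /s.
  have -> : (4 / e * w)^-1 / 2 * (1 + w ^+ 2) = e / 4 * ((1 + w ^+ 2) / (2 * w)).
    by field; apply/andP; split; lra.
  rewrite ler_pM2l ?divr_gt0// ler_pdivrMr; last lra.
  by nra.
rewrite -/w; lra.
Qed.

End tiltable.

(** The next index is always taken far enough for the chosen ones.  All values
    of [s] satisfy [G], also beyond [k], so that [s] indexes a family of objects
    with property [G]. *)
Lemma eventually_pairwise_family (G : nat -> Prop) (Q : nat -> nat -> Prop) k :
  (\forall j \near \oo, G j) -> (forall i, G i -> \forall j \near \oo, Q i j) ->
  exists s : nat -> nat, (forall m, G (s m)) /\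
    forall i j, (i < j < k)%N -> Q (s i) (s j).
Proof.
move=> nG nQ; elim: k => [|k [s [Gs Qs]]].
  by have [j Gj] := filter_ex nG; exists (fun=> j); split=> // i ?; rewrite ltn0 andbF.
have nQs : \forall j \near \oo, forall i : 'I_k, Q (s i) j.
  by apply: filter_forall => i; exact/nQ/Gs.
have [j [Gj Qj]] := filter_ex (filterI nG nQs).
exists (fun m => if (m < k)%N then s m else j); split=> [m|a b /andP[ab]].
  by case: ifP.
rewrite ltnS leq_eqVlt => /orP[/eqP bk|bk].
  by rewrite bk ltnn -bk ab; apply: (Qj (Ordinal (_ : a < k)%N)); rewrite -bk.
by rewrite bk (ltn_trans ab bk); apply: Qs; rewrite ab.
Qed.

(** * Products of tilted factors over a sample *)

Lemma bernoulli_ineq {R : realDomainType} (x : R) n :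
  0 <= x -> 1 + n%:R * x <= (1 + x) ^+ n.
Proof.
move=> x0; elim: n => [|n IH]; first by rewrite mul0r addr0 expr0.
rewrite exprS; apply: (@le_trans _ _ ((1 + x) * (1 + n%:R * x))).
  have : 0 <= n%:R * x * x by rewrite !mulr_ge0.
  by rewrite -natr1; lra.
by rewrite ler_wpM2l// addr_ge0.
Qed.

Section normalized_tilt.
Context {d} {T : measurableType d} {R : realType} (L : probability T R).

Let itg (f : T -> R) := L.-integrable setT (EFin \o f).

(** With this weight, [p (r - 1)] has variance [t^2 / n] when [r] has variance
    [v]: the scale on which a mixture is contiguous to the null law. *)
Definition local_weight (t v : R) (n : nat) : R := t / Num.sqrt (n%:R * v).

Definition normalized_tilt (r b : T -> R) (p : R) (x : T) : R :=
  tilt r b p x / \int[L]_y tilt r b p y.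

Lemma local_weight_le (t v : R) n : 0 < t -> (0 < n)%N -> 1 <= v ->
  0 < local_weight t v n <= t / Num.sqrt n%:R.
Proof.
move=> t0 n0 v1; have nR : (0 : R) < n%:R by rewrite ltr0n.
have s0 : 0 < Num.sqrt (n%:R * v) by rewrite sqrtr_gt0 mulr_gt0//; lra.
have v0 : 0 < v by lra.
rewrite divr_gt0//= ler_pM2l// lef_pV2 ?posrE ?sqrtr_gt0//; last first.
  by rewrite mulr_gt0.
by apply: ler_wsqrtr; rewrite ler_peMr// ltW.
Qed.

Lemma local_weight_sqr (t v : R) n : (0 < n)%N -> 1 <= v ->
  local_weight t v n ^+ 2 = t ^+ 2 / (n%:R * v).
Proof.
move=> n0 v1; rewrite exprMn exprVn sqr_sqrtr// mulr_ge0//; lra.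
Qed.

Lemma tilt_mean_ge1 r b v K p : unit_mean_ratio L r v ->
  square_cutoff L r b v K -> 1 <= \int[L]_x tilt r b p x.
Proof.
move=> rv bK; have Ir := ratio_integrable rv; have Ib := cutoff_integrable bK.
case: rv => _ _ _ E1 _ _; case: bK => _ bK _ _.
rewrite Rintegral_tilt// lerDl mulr_ge0 ?divr_ge0 ?sqr_ge0//.
by apply: Rintegral_ge0 => x _; have /andP[] := bK x.
Qed.

(** One factor has mean at least [1 + t^2 / (8 n)], because the cutoff keeps half
    of the variance. *)
Lemma tilt_mean_exp_ge r b v K t n : (0 < n)%N -> unit_mean_ratio L r v ->
  square_cutoff L r b v K ->
  1 + t ^+ 2 / 8 <= (\int[L]_x tilt r b (local_weight t v n) x) ^+ n.
Proof.
move=> n0 rv bK; have nR : (0 : R) < n%:R by rewrite ltr0n.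
have Ir := ratio_integrable rv; have Ib := cutoff_integrable bK.
case: rv => _ _ _ E1 _ v1; case: bK => _ _ _ Eb.
rewrite Rintegral_tilt// local_weight_sqr//.
have h : t ^+ 2 / 8 / n%:R <= t ^+ 2 / (n%:R * v) / 4 * \int[L]_x b x.
  have -> : t ^+ 2 / 8 / n%:R = t ^+ 2 / (n%:R * v) / 4 * (v / 2).
    by field; rewrite !gt_eqF//; lra.
  rewrite ler_wpM2l// !divr_ge0 ?sqr_ge0// mulr_ge0//; lra.
have h0 : 0 <= t ^+ 2 / 8 / n%:R by rewrite !divr_ge0// sqr_ge0.
apply: (@le_trans _ _ ((1 + t ^+ 2 / 8 / n%:R) ^+ n)).
  apply: le_trans (bernoulli_ineq n h0).
  by rewrite mulrCA divff ?gt_eqF// mulr1.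
by rewrite lerXn2r ?nnegrE ?lerD2l ?addr_ge0// (le_trans h0).
Qed.

(** Each factor contributes [1 + (t^2 rho + B / sqrt n) / n], where the term in
    [B] collects the terms of third and fourth order in the weights; normalizing
    by means that are at least 1 does not increase the error. *)
Lemma normalized_tilt_mul_exp r1 r2 b1 b2 v1 v2 K1 K2 (t rho e : R) :
  unit_mean_ratio L r1 v1 -> unit_mean_ratio L r2 v2 ->
  square_cutoff L r1 b1 v1 K1 -> square_cutoff L r2 b2 v2 K2 ->
  0 < t -> 0 <= rho -> 0 < e ->
  \int[L]_x (r1 x * r2 x) <= 1 + rho * (Num.sqrt v1 * Num.sqrt v2) ->
  \forall n \near \oo,
    let u1 := normalized_tilt r1 b1 (local_weight t v1 n) in
    let u2 := normalized_tilt r2 b2 (local_weight t v2 n) in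
    itg (fun x => u1 x * u2 x) /\
    (\int[L]_x (u1 x * u2 x)) ^+ n <= expR (t ^+ 2 * rho + e).
Proof.
move=> rv1 rv2 bK1 bK2 t0 rho0 e0 E12.
have I1 := ratio_integrable rv1; have I2 := ratio_integrable rv2.
have I12 := ratio_mul_integrable rv1 rv2.
have Ib1 := cutoff_integrable bK1; have Ib2 := cutoff_integrable bK2.
have m1 p := tilt_mean_ge1 p rv1 bK1; have m2 p := tilt_mean_ge1 p rv2 bK2.
case: rv1 => mr1 r10 _ E1 _ v11; case: rv2 => mr2 r20 _ E2 _ v21.
case: bK1 => mb1 bK1 _ _; case: bK2 => mb2 bK2 _ _.
pose K := K1 + K2.
have K10 : 0 <= K1.
  by have /andP[+ ] := bK1 point; exact: le_trans.
have K20 : 0 <= K2.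
  by have /andP[+ ] := bK2 point; exact: le_trans.
have K0 : 0 <= K by rewrite addr_ge0.
have b1K x : 0 <= b1 x <= K.
  by have /andP[-> h] := bK1 x; rewrite (le_trans h)// lerDl.
have b2K x : 0 <= b2 x <= K.
  by have /andP[-> h] := bK2 x; rewrite (le_trans h)// lerDr.
pose B := t ^+ 3 * K / 2 + t ^+ 4 * K ^+ 2 / 16.
have B0 : 0 <= B.
  by rewrite addr_ge0// divr_ge0// mulr_ge0// ?exprn_ge0// ltW.
have near_n : \forall n \near \oo, 1 + t ^+ 2 + (B / e) ^+ 2 <= n%:R.
  exact: nbhs_infty_ger.
apply: filterS near_n => n hn.
have Be0 := sqr_ge0 (B / e); have t20 := sqr_ge0 t.
have nR : (0 : R) < n%:R by lra.
have n0 : (0 < n)%N by rewrite -(ltr0n R).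
pose q := Num.sqrt n%:R : R.
have q2 : q ^+ 2 = n%:R by rewrite sqr_sqrtr// ltW.
have q0 : 0 < q by rewrite sqrtr_gt0.
have q1 : 1 <= q by rewrite -sqrtr1 ler_sqrt//; lra.
have tq : t <= q.
  by rewrite -(@ler_pXn2r _ 2) ?nnegrE ?q2//; lra.
have Beq : B / q <= e.
  rewrite ler_pdivrMr// mulrC -ler_pdivrMr//.
  by rewrite -(@ler_pXn2r _ 2) ?nnegrE ?q2 ?divr_ge0//; lra.
set p1 := local_weight t v1 n; set p2 := local_weight t v2 n.
have /andP[p10 p1q] := local_weight_le t0 n0 v11.
have /andP[p20 p2q] := local_weight_le t0 n0 v21.
rewrite -/p1 -/p2 -/q in p10 p1q p20 p2q.
have tq1 : t / q <= 1 by rewrite ler_pdivrMr// mul1r.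
have p1P : 0 <= p1 <= 1 by rewrite ltW// (le_trans p1q).
have p2P : 0 <= p2 <= 1 by rewrite ltW// (le_trans p2q).
have [It Et] := Rintegral_tilt_mul mr1 mr2 mb1 mb2 r10 r20 b1K b2K I1 I2 I12
  Ib1 Ib2 E1 E2 E12 p1P p2P.
pose u1 := normalized_tilt r1 b1 p1; pose u2 := normalized_tilt r2 b2 p2.
rewrite -/u1 -/u2.
set M1 := \int[L]_x tilt r1 b1 p1 x in Et.
set M2 := \int[L]_x tilt r2 b2 p2 x in Et.
have M11 : 1 <= M1 := m1 p1; have M21 : 1 <= M2 := m2 p2.
have uE : (fun x => u1 x * u2 x) =
    (fun x => (M1 * M2)^-1 * (tilt r1 b1 p1 x * tilt r2 b2 p2 x)).
  apply/funext => x; rewrite /u1 /u2 /normalized_tilt -/p1 -/p2 -/M1 -/M2.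
  by field; rewrite !gt_eqF//; lra.
have Iu : itg (fun x => u1 x * u2 x).
  by rewrite uE; exact: (integrableZl measurableT (M1 * M2)^-1 It).
split => //.
have pq k l : p1 ^+ k * p2 ^+ l <= (t / q) ^+ (k + l).
  have tq0 : 0 <= t / q by rewrite divr_ge0// ltW.
  have h1 : p1 ^+ k <= (t / q) ^+ k by rewrite lerXn2r// nnegrE// ltW.
  have h2 : p2 ^+ l <= (t / q) ^+ l by rewrite lerXn2r// nnegrE// ltW.
  by rewrite exprD ler_pM// exprn_ge0// ltW.
set X := (X in _ + X) in Et.
have X0 : 0 <= X.
  have p10' := ltW p10; have p20' := ltW p20.
  have sv0 : 0 <= Num.sqrt v1 * Num.sqrt v2 by rewrite mulr_ge0// sqrtr_ge0.
  have h1 : 0 <= p1 ^+ 2 := sqr_ge0 p1.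
  have h2 : 0 <= p2 ^+ 2 := sqr_ge0 p2.
  apply: addr_ge0; [apply: addr_ge0|].
  - exact: mulr_ge0 (mulr_ge0 p10' p20') (mulr_ge0 rho0 sv0).
  - apply: mulr_ge0 K0; apply: divr_ge0 => //.
    exact: addr_ge0 (mulr_ge0 h2 p10') (mulr_ge0 h1 p20').
  - by apply: mulr_ge0 (sqr_ge0 K); apply: divr_ge0 => //; exact: mulr_ge0.
have XB : X <= (t ^+ 2 * rho + e) / n%:R.
  have s1 : Num.sqrt v1 != 0 by rewrite gt_eqF// sqrtr_gt0; lra.
  have s2 : Num.sqrt v2 != 0 by rewrite gt_eqF// sqrtr_gt0; lra.
  have first : p1 * p2 * (rho * (Num.sqrt v1 * Num.sqrt v2)) = t ^+ 2 * rho / n%:R.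
    rewrite /p1 /p2 /local_weight !sqrtrM ?(ltW nR)// -/q -q2.
    by field; rewrite s1 s2 gt_eqF.
  have rest : (p2 ^+ 2 * p1 + p1 ^+ 2 * p2) / 4 * K +
      p1 ^+ 2 * p2 ^+ 2 / 16 * K ^+ 2 <= e / n%:R.
    have := pq 1%N 2%N; have := pq 2%N 1%N; have := pq 2%N 2%N.
    rewrite !expr1 => h22 h21 h12.
    apply: (@le_trans _ _ (B / q / n%:R)); last by rewrite ler_pM2r ?invr_gt0.
    have -> : B / q / n%:R = (t / q) ^+ 3 * K / 2
       + t ^+ 4 / (q ^+ 3) * (K ^+ 2) / 16.
      by rewrite /B -q2; field; rewrite gt_eqF.
    have c4 : (t / q) ^+ 4 <= t ^+ 4 / q ^+ 3.
      rewrite exprMn exprVn ler_pM2l ?exprn_gt0// lef_pV2 ?posrE ?exprn_gt0//.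
      by rewrite (exprS q 3) ler_peMl// exprn_ge0// ltW.
    have := ler_wpM2r (sqr_ge0 K) (le_trans h22 c4).
    have := ler_wpM2r K0 h21; have := ler_wpM2r K0 h12.
    lra.
  by rewrite /X -addrA first [leRHS]mulrDl lerD2l.
have Eu : \int[L]_x (u1 x * u2 x) <= 1 + (t ^+ 2 * rho + e) / n%:R.
  rewrite uE RintegralZl// ler_pdivrMl; last by rewrite mulr_gt0//; lra.
  apply: (le_trans Et).
  have M12 : 1 <= M1 * M2 by rewrite -[X in X <= _]mulr1 ler_pM.
  have : X <= M1 * M2 * ((t ^+ 2 * rho + e) / n%:R).
    by apply: (le_trans XB); rewrite ler_peMl// (le_trans X0).
  lra.
have u0 : 0 <= \int[L]_x (u1 x * u2 x).
  rewrite uE; apply: Rintegral_ge0 => x _; rewrite mulr_ge0//.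
    by rewrite invr_ge0 mulr_ge0//; lra.
  have nn b r (bb : forall x, 0 <= b x <= K) (rr : forall x, 0 <= r x) p
    (pp : 0 <= p <= 1) := tilt_ge0 rr (fun x => (andP (bb x)).1) pp.
  by rewrite mulr_ge0//; exact: nn.
have -> : t ^+ 2 * rho + e = n%:R * ((t ^+ 2 * rho + e) / n%:R).
  by field; rewrite gt_eqF.
rewrite expRM_natl lerXn2r ?nnegrE ?expR_ge0//.
exact: le_trans Eu (expR_ge1Dx _).
Qed.

Lemma Rintegral_normalized_tilt r b v K p : unit_mean_ratio L r v ->
  square_cutoff L r b v K -> \int[L]_x normalized_tilt r b p x = 1.
Proof.
move=> rv bK; have m1 := tilt_mean_ge1 p rv bK.
rewrite RintegralZr ?divff// ?gt_eqF//; first by lra.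
by apply: integrable_tilt; [exact: ratio_integrable rv|exact: cutoff_integrable bK].
Qed.

End normalized_tilt.

Section iid.
Context {d d'} {Omega : measurableType d} {T : measurableType d'}
  {R : realType} (P : probability Omega R) (X : nat -> {RV P >-> T}).
Hypothesis X_indep : mutually_independent X.
Hypothesis X_ident : forall i (A : set T), measurable A ->
  P (X i @^-1` A) = P (X 0%N @^-1` A).

Let L : probability T R := distribution P (X 0%N).

Lemma integral_iid_prod (g : T -> R) n : measurable_fun setT g ->
  (forall x, 0 <= g x) -> L.-integrable setT (EFin \o g) ->
  (\int[P]_w (\prod_(i < n) g (X i w))%:E)%E = ((\int[L]_x g x) ^+ n)%:E.
Proof.
move=> mg g0 Ig.
have E i : (\int[P]_w (g (X i w))%:E = (\int[L]_x g x)%:E)%E.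
  have mgE : measurable_fun [set: T] (fun x => (g x)%:E) by exact/measurable_EFinP.
  have gE0 x : (0 <= (g x)%:E)%E by rewrite lee_fin.
  have -> : (\int[P]_w (g (X i w))%:E = \int[distribution P (X i)]_x (g x)%:E)%E.
    by rewrite ge0_integral_distribution.
  have -> : (\int[distribution P (X i)]_x (g x)%:E = \int[L]_x (g x)%:E)%E.
    by apply: eq_measure_integral => A mA _; exact: X_ident.
  by rewrite /Rintegral fineK//; exact: integrable_fin_num.
have := integral_prod_independent X_indep (fun=> mg) (fun=> g0) E
  (iota_uniq 0 n).
have toord (F : nat -> R) : \prod_(i <- iota 0 n) F i = \prod_(i < n) F i.
  by rewrite -(big_mkord xpredT F) /index_iota subn0.
rewrite toord prodr_const card_ord => <-.
by apply: eq_integral => w _; rewrite toord.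
Qed.

(** The products have mean 1; their covariances are at most
    [exp (t^2 rho + e) - 1] off the diagonal and their second moments at most
    [exp (t^2 + e)], the diagonal being the case [rho = 1]. *)
Lemma tilted_products_tail (k : nat) (r b : nat -> T -> R) (v K : nat -> R)
    (t rho e : R) :
  (0 < k)%N ->
  (forall j, unit_mean_ratio L (r j) (v j)) ->
  (forall j, square_cutoff L (r j) (b j) (v j) (K j)) ->
  (forall i j, (i < k)%N -> (j < k)%N -> i != j ->
    \int[L]_x (r i x * r j x) <= 1 + rho * (Num.sqrt (v i) * Num.sqrt (v j))) ->
  0 < t -> 0 <= rho -> 0 < e ->
  \forall n \near \oo,
    (P (\bigcap_(j in `I_k) [set w |
        (\prod_(i < n) normalized_tilt L (r j) (b j)
           (local_weight t (v j) n) (X i w) <= 2^-1)%R])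
     <= (4 * (expR (t ^+ 2 + e) / k%:R + (expR (t ^+ 2 * rho + e) - 1)))%:E)%E.
Proof.
move=> k0 rv bK orth t0 rho0 e0.
pose u n j := normalized_tilt L (r j) (b j) (local_weight t (v j) n).
have near_pairs : \forall n \near \oo, forall ij : 'I_k * 'I_k,
    L.-integrable setT (EFin \o (fun x => u n ij.1 x * u n ij.2 x)) /\
    (\int[L]_x (u n ij.1 x * u n ij.2 x)) ^+ n
      <= expR (t ^+ 2 * (if ij.1 == ij.2 then 1 else rho) + e).
  apply: filter_forall => -[i j] /=.
  apply: normalized_tilt_mul_exp => //; try exact: rv; try exact: bK.
    by case: ifP.
  case: ifPn => [/eqP <-|ij]; last exact: orth.
  have [_ _ _ _ + v1] := rv i.
  under eq_Rintegral do rewrite expr2.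
  by move=> ->; rewrite mul1r -expr2 sqr_sqrtr//; lra.
have near_n : \forall n \near \oo, 1 + t ^+ 2 <= n%:R :> R.
  exact: nbhs_infty_ger.
apply: filterS2 near_pairs near_n => n Hn tn.
have t20 := sqr_ge0 t.
have nR : (0 : R) < n%:R by lra.
have n0 : (0 < n)%N by rewrite -(ltr0n R).
have p01 j : 0 <= local_weight t (v j) n <= 1.
  have [_ _ _ _ _ v1] := rv j.
  have /andP[p0 p1] := local_weight_le t0 n0 v1.
  rewrite (ltW p0)/= (le_trans p1)// ler_pdivrMr ?sqrtr_gt0// mul1r.
  by rewrite -(@ler_pXn2r _ 2) ?nnegrE ?sqrtr_ge0 ?sqr_sqrtr//; lra.
have mu j : measurable_fun setT (u n j).
  have [mr _ _ _ _ _] := rv j; have [mb _ _ _] := bK j.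
  by apply: measurable_funM => //; exact: measurable_tilt.
have u0 j x : 0 <= u n j x.
  have [_ r0 _ _ _ _] := rv j; have [_ b0K _ _] := bK j.
  apply: divr_ge0; last exact: le_trans ler01 (tilt_mean_ge1 _ (rv j) (bK j)).
  by apply: tilt_ge0 => // y; have /andP[] := b0K y.
have Iu j : L.-integrable setT (EFin \o u n j).
  have Ir := ratio_integrable (rv j); have Ib := cutoff_integrable (bK j).
  have := integrableZr measurableT (\int[L]_y tilt (r j) (b j) (local_weight t (v j) n) y)^-1
    (integrable_tilt (local_weight t (v j) n) Ir Ib).
  by apply: eq_integrable.
pose G j w := \prod_(i < n) u n j (X i w).
have GG i j : (i < k)%N -> (j < k)%N -> (\int[P]_w (G i w * G j w)%:E <=
    (expR (t ^+ 2 * (if i == j then 1 else rho) + e))%:E)%E.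
  move=> ik jk; have [Iij Eij] := Hn (Ordinal ik, Ordinal jk).
  have -> : (\int[P]_w (G i w * G j w)%:E =
     \int[P]_w (\prod_(m < n) (u n i (X m w) * u n j (X m w)))%:E)%E.
    by apply: eq_integral => w _; rewrite /G -big_split.
  rewrite (integral_iid_prod _ _ _ Iij) ?lee_fin//.
    exact: measurable_funM.
  by move=> x; rewrite mulr_ge0.
apply: (second_moment_lower_tail (G := G) k0).
- move=> j; apply: measurable_prod => i _.
  exact: measurableT_comp.
- by move=> j w; apply: prodr_ge0.
- move=> j _; rewrite integral_iid_prod//.
  by rewrite (Rintegral_normalized_tilt _ (rv j) (bK j)) expr1n.
- by move=> i ik; have := GG i i ik ik; rewrite eqxx mulr1.
- move=> i j ik jk ij; have := GG i j ik jk; rewrite (negbTE ij).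
  by move=> /le_trans; apply; rewrite lee_fin; lra.
have : 1 + (t ^+ 2 * rho + e) <= expR (t ^+ 2 * rho + e) by exact: expR_ge1Dx.
have := mulr_ge0 t20 rho0; lra.
Qed.

End iid.

(** * The likelihood ratio statistic *)

Lemma lne_sum_expR {R : realType} n (g : 'I_n -> R) : (forall i, 0 < g i) ->
  exists s : R, (\sum_(i < n) lne (g i)%:E = s%:E)%E /\ expR s = \prod_(i < n) g i.
Proof.
move=> g0; exists (\sum_(i < n) ln (g i)); split.
  by rewrite -sumEFin; apply: eq_bigr => i _; rewrite lne_EFin.
rewrite (big_morph _ (@expRD R) (@expR0 R)); apply: eq_bigr => i _.
by rewrite lnK// posrE.
Qed.

Section likelihood.
Context {d d'} {Omega : measurableType d} {T : measurableType d'}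
  {R : realType} {Theta Gamma : Type}.
Context (f : Theta -> Gamma -> T -> R) (eta0 : Theta) (gamma0 : Gamma).
Context (P : probability Omega R) (X : nat -> {RV P >-> T}).

(** The mixture density is the null density times the factor
    [1 + p (r - 1)].  A vanishing factor makes the product 0; otherwise all
    logarithms are finite and the null log-likelihood cancels. *)
Lemma lr_ge_mixture_ratio n w M p theta :
  (forall i : nat, 0 < f eta0 gamma0 (X i w)) -> (forall x, 0 <= f theta gamma0 x) ->
  (lr f eta0 gamma0 X n w <= M%:E)%E -> 0 <= p <= 1 ->
  \prod_(i < n) (1 + p * (density_ratio f eta0 gamma0 theta (X i w) - 1)) <= expR M.
Proof.
move=> a0 c0 lrM p01; have /andP[p0 p1] := p01.
pose r i := density_ratio f eta0 gamma0 theta (X i w).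
have r0 i : 0 <= r i by rewrite divr_ge0// ltW.
have fac0 i : 0 <= 1 + p * (r i - 1).
  by have := mulr_ge0 p0 (r0 i); lra.
have [/existsP[i /eqP i0]|] := boolP [exists i : 'I_n, 1 + p * (r i - 1) == 0].
  by rewrite (bigD1 i)//= -/(r i) i0 mul0r expR_ge0.
rewrite negb_exists => /forallP facN.
have fac i : (i < n)%N -> 0 < 1 + p * (r i - 1).
  by move=> ilt; rewrite lt_neqAle fac0 andbT eq_sym (facN (Ordinal ilt)).
have mixE i : mixture f eta0 gamma0 p theta (X i w) =
    f eta0 gamma0 (X i w) * (1 + p * (r i - 1)).
  by rewrite /mixture /r /density_ratio; field; rewrite gt_eqF.
have [s0 [s0E s0X]] := lne_sum_expR (fun i : 'I_n => a0 i).
have mix0 (i : 'I_n) : 0 < mixture f eta0 gamma0 p theta (X i w).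
  by rewrite mixE mulr_gt0// fac.
have [s1 [s1E s1X]] := lne_sum_expR mix0.
have s10 : s1 <= M + s0.
  move: lrM; rewrite /lr /null_loglik s0E leeBlDr// -EFinD => h.
  rewrite -lee_fin; apply: le_trans h; rewrite -s1E.
  by apply: ereal_sup_ubound; exists (p, theta) => //; split=> //=; rewrite in_itv.
have : expR s1 <= expR M * expR s0 by rewrite -expRD ler_expR.
rewrite s1X s0X; under eq_bigr do rewrite mixE.
by rewrite big_split/= mulrC ler_pM2r// prodr_gt0.
Qed.

End likelihood.

Lemma measurable_density_ratio {d d'} {Omega : measurableType d}
  {T : measurableType d'} {R : realType} {Theta Gamma : Type}
  (f : Theta -> Gamma -> T -> R) eta0 gamma0 theta :
  (forall theta, measurable_fun setT (f theta gamma0)) ->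
  (forall x, 0 <= f eta0 gamma0 x) ->
  measurable_fun setT (density_ratio f eta0 gamma0 theta).
Proof.
move=> mf f0; apply: measurable_funM => //.
have -> : (fun x => (f eta0 gamma0 x)^-1) =
   (fun x => powR (f eta0 gamma0 x) (-1)).
  by apply/funext => x; rewrite powR_inv1.
exact: (measurableT_comp (measurable_powR (-1))).
Qed.

Theorem theorem1 (R : realType)
  (dT : measure_display) (T : measurableType dT)
  (mu : {sigma_finite_measure set T -> \bar R})
  (Theta Gamma : Type) (f : Theta -> Gamma -> T -> R)
  (f_density : forall theta gamma, is_density mu (f theta gamma))
  (eta0 : Theta) (gamma0 : Gamma)
  (dO : measure_display) (Omega : measurableType dO)
  (P : probability Omega R) (X : nat -> {RV P >-> T})
  (X_indep : mutually_independent X)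
  (X_density : forall i, has_density mu (X i) (f eta0 gamma0))
  (ratio_mean : forall theta,
     ('E_P[fun w => density_ratio f eta0 gamma0 theta (X 0%N w)] = 1)%E)
  (profile_expansion : forall theta,
     finite_variance_set f eta0 gamma0 X theta ->
     (0 < score_variance f eta0 gamma0 X theta)%E ->
     is_op1 P (fun n w =>
       (2%:E * profile_lr f eta0 gamma0 X n theta w
        - (Num.max 0 (std_score f eta0 gamma0 X n theta w) ^+ 2)%R%:E)%E))
  (variance_unbounded : exists thetas : nat -> Theta,
     (forall i, finite_variance_set f eta0 gamma0 X (thetas i)) /\
     score_variance f eta0 gamma0 X (thetas i) @[i --> \oo] --> +oo%E) :
  cvg_pinfty_in_probability P (fun n w => lr f eta0 gamma0 X n w).
Proof.
have mf theta : measurable_fun setT (f theta gamma0) by case: (f_density theta gamma0).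
have f0 theta x : 0 <= f theta gamma0 x by case: (f_density theta gamma0).
pose r theta := density_ratio f eta0 gamma0 theta.
have mr theta : measurable_fun setT (r theta) by exact: measurable_density_ratio.
have r0 theta x : 0 <= r theta x by rewrite divr_ge0.
have X_ident i (A : set T) : measurable A -> P (X i @^-1` A) = P (X 0%N @^-1` A).
  by move=> mA; rewrite !X_density.
pose L : probability T R := distribution P (X 0%N).
have to_law (g : T -> R) : measurable_fun setT g -> (forall x, 0 <= g x) ->
    (\int[L]_x (g x)%:E = 'E_P[fun w => g (X 0%N w)])%E.
  move=> mg g0.
  have mgE : measurable_fun setT (fun x => (g x)%:E) by exact/measurable_EFinP.
  have gE0 x : (0 <= (g x)%:E)%E by rewrite lee_fin.
  by rewrite unlock ge0_integral_distribution.
have r1 theta : \int[L]_x r theta x = 1.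
  by rewrite /Rintegral to_law// ratio_mean.
have unit theta : finite_variance_set f eta0 gamma0 X theta ->
    1 <= fine (score_variance f eta0 gamma0 X theta) ->
    unit_mean_ratio L (r theta) (fine (score_variance f eta0 gamma0 X theta)).
  have mr2 : measurable_fun setT (fun x => r theta x ^+ 2).
    exact: measurable_funX.
  rewrite /finite_variance_set/= /score_variance => fin v1.
  have E2 := to_law _ mr2 (fun x => sqr_ge0 _).
  have E2fin : ('E_P[fun w => (r theta (X 0%N w) ^+ 2)%R])%E \is a fin_num.
    rewrite ge0_fin_numE; first by move: fin; rewrite lteBlDr.
    by rewrite -E2; apply: integral_ge0 => x _; rewrite lee_fin sqr_ge0.
  split => //.
  - apply/integrableP; split; first exact/measurable_EFinP.
    under eq_integral do rewrite /= ger0_norm ?sqr_ge0//.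
    by rewrite E2 -ge0_fin_numE// -E2; apply: integral_ge0 => x _; rewrite lee_fin sqr_ge0.
  - rewrite /Rintegral E2 fineB//=; first by rewrite addrC subrK.
have [thetas [thetas_fin thetas_oo]] := variance_unbounded.
pose v j := fine (score_variance f eta0 gamma0 X (thetas j)).
have v_near A : \forall j \near \oo, A <= v j.
  move/cvgeyPge : thetas_oo => /(_ A); apply: filterS => j.
  have := thetas_fin j; rewrite /finite_variance_set/= /v.
  by case: (score_variance _ _ _ _ _).
move=> M M0.
suff main (e : R) : 0 < e -> \forall n \near \oo,
    (mu_ext P [set w | (lr f eta0 gamma0 X n w <= M%:E)%E] <= e%:E)%E.
  apply/fine_cvgP; split.
    apply: filterS (main 1 ltr01) => n h.
    by rewrite ge0_fin_numE ?mu_ext_ge0// (le_lt_trans h)// ltry.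
  apply/cvgrPdist_le => e e0; apply: filterS (main e e0) => n h.
  rewrite sub0r normrN /= ger0_norm ?fine_ge0 ?mu_ext_ge0//.
  rewrite -lee_fin fineK// ge0_fin_numE ?mu_ext_ge0//.
  by rewrite (le_lt_trans h)// ltry.
move=> e0.
(* Then [t^2 / 8 = 2 exp (2 M)], twice the bound on the squared products. *)
pose t := 4 * expR M.
have t0 : 0 < t by rewrite mulr_gt0// expR_gt0.
(* Chosen so that [exp (2 del) - 1 = e / 8] bounds the covariances below. *)
pose del := ln (1 + e / 8) / 2.
have e80 : 0 < e / 8 by rewrite divr_gt0.
have del0 : 0 < del by rewrite divr_gt0// ln_gt0// ltrDl.
pose rho := del / t ^+ 2.
have rho0 : 0 < rho by rewrite divr_gt0// exprn_gt0.
pose k := (Num.truncn (expR (t ^+ 2 + del) * 8 / e)).+1.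
pose Q i j := \int[L]_x (r (thetas i) x * r (thetas j) x)
  <= 1 + rho * (Num.sqrt (v i) * Num.sqrt (v j)).
have [s [s1 sQ]] : exists s : nat -> nat, (forall m, 1 <= v (s m)) /\
    forall i j, (i < j < k)%N -> Q (s i) (s j).
  apply: (@eventually_pairwise_family (fun j => 1 <= v j) Q k).
    exact: v_near.
  move=> i vi.
  have [V HV] := asymptotic_orthogonality (unit _ (thetas_fin i) vi) rho0.
  apply: filterS2 (v_near 1) (v_near V) => j v1 vV.
  exact: HV (unit _ (thetas_fin j) v1) vV.
pose rs m := r (thetas (s m)); pose vs m := v (s m).
have urs m : unit_mean_ratio L (rs m) (vs m) := unit _ (thetas_fin _) (s1 m).
have [bK HbK] : {bK : nat -> (T -> R) * R &
    forall m, square_cutoff L (rs m) (bK m).1 (vs m) (bK m).2}.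
  apply: (@choice _ _ (fun m (bK : (T -> R) * R) =>
    square_cutoff L (rs m) bK.1 (vs m) bK.2)) => m.
  have [b [K ?]] := square_cutoff_exists (urs m).
  by exists (b, K).
have orth i j : (i < k)%N -> (j < k)%N -> i != j ->
    \int[L]_x (rs i x * rs j x) <= 1 + rho * (Num.sqrt (vs i) * Num.sqrt (vs j)).
  move=> ik jk; rewrite neq_ltn => /orP[ij|ji].
    by apply: sQ; rewrite ij.
  rewrite (mulrC (Num.sqrt _)); under eq_Rintegral do rewrite mulrC.
  by apply: sQ; rewrite ji.
have tail := tilted_products_tail X_indep X_ident (ltn0Sn _ : (0 < k)%N) urs HbK
  orth t0 (ltW rho0) del0.
(* Off [N], no observed null density vanishes. *)
pose N := \bigcup_i (X i @^-1` [set x | f eta0 gamma0 x = 0]).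
have mNi : measurable [set x | f eta0 gamma0 x = 0].
  have -> : [set x | f eta0 gamma0 x = 0] = f eta0 gamma0 @^-1` [set 0] by [].
  by rewrite -[X in measurable X]setTI; apply: mf.
have mN : measurable N.
  apply: bigcup_measurable => i _.
  by rewrite -[X in measurable X]setTI; apply: measurable_funP.
have PN : P N = 0%E.
  apply: measure_negligible => //; apply: negligible_bigcup => i.
  apply/negligibleP.
    by rewrite -[X in measurable X]setTI; apply: measurable_funP.
  rewrite [LHS](X_density i _ mNi) (eq_integral (cst 0%E)) ?integral0//.
  by move=> x; rewrite inE /= => ->.
have near_n : \forall n \near \oo, 1 + t ^+ 2 <= n%:R :> R.
  exact: nbhs_infty_ger.
apply: filterS2 tail near_n => n; set A := (X in P X) => PA tn.
have t20 := sqr_ge0 t.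
have nR : (0 : R) < n%:R by lra.
have n0 : (0 < n)%N by rewrite -(ltr0n R).
have mA : measurable A.
  apply: bigcap_measurableType => // j _; set F := (X in measurable X).
  have -> : F = (fun w => \prod_(i < n) normalized_tilt L (rs j) (bK j).1
      (local_weight t (vs j) n) (X i w)) @^-1` `]-oo, 2^-1]%classic.
    by apply/seteqP; split => w; rewrite /F /= in_itv.
  rewrite -[X in measurable X]setTI.
  apply: measurable_prod => // i _; apply: measurableT_comp => //.
  apply: measurable_funM => //; apply: measurable_tilt; first exact: mr.
  by case: (HbK j).
apply: (@le_trans _ _ (mu_ext P (A `|` N))).
  apply: le_mu_ext => w /= lrM.
  have [Nw|Nw] := pselect (N w); first by right.
  left => j _ /=.
  have [_ rj0 _ _ _ v1] := urs j; have [_ _ bsq _] := HbK j.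
  set p := local_weight t (vs j) n.
  have p01 : 0 <= p <= 1.
    have /andP[p0 p1] := local_weight_le t0 n0 v1.
    rewrite (ltW p0)/= (le_trans p1)// ler_pdivrMr ?sqrtr_gt0// mul1r.
    by rewrite -(@ler_pXn2r _ 2) ?nnegrE ?sqrtr_ge0 ?sqr_sqrtr//; lra.
  have p201 : 0 <= p / 2 <= 1 by have /andP[] := p01; lra.
  have pos i : 0 < f eta0 gamma0 (X i w).
    by rewrite lt_neqAle f0 andbT eq_sym; apply/eqP => fX0; apply: Nw; exists i.
  have := lr_ge_mixture_ratio pos (f0 (thetas (s j))) lrM p201.
  rewrite -/(r _) -/(rs j); set Y := \prod_(i < n) _ => YM.
  have Y0 : 0 <= Y.
    apply: prodr_ge0 => i _; have := rj0 (X i w); have /andP[] := p201; nra.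
  have mean_big := tilt_mean_exp_ge t n0 (urs j) (HbK j).
  rewrite -/p in mean_big.
  rewrite big_split/= prodr_const card_ord exprVn.
  have mean0 : 0 < (\int[L]_y tilt (rs j) (bK j).1 p y) ^+ n.
    by apply: lt_le_trans mean_big; have := sqr_ge0 t; lra.
  rewrite ler_pdivrMr//.
  apply: (@le_trans _ _ (Y ^+ 2)).
    rewrite /Y -prodrXl; apply: ler_prod => i _; rewrite tilt_le_sqr// andbT.
    by apply: tilt_ge0 => // x; have [_ /(_ x)/andP[]] := HbK j.
  apply: (@le_trans _ _ (expR M ^+ 2)); first by rewrite lerXn2r ?nnegrE// expR_ge0.
  apply: (@le_trans _ _ (2^-1 * (1 + t ^+ 2 / 8))); last by rewrite ler_pM2l ?invr_gt0.
  by rewrite /t exprMn; lra.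
have -> : mu_ext P (A `|` N) = P A.
  rewrite measurable_mu_extE; last exact: measurableU.
  exact: measureU0.
apply: (le_trans PA); rewrite lee_fin.
have t2rho : t ^+ 2 * rho = del by rewrite /rho mulrC divfK// gt_eqF// exprn_gt0.
have -> : expR (t ^+ 2 * rho + del) = 1 + e / 8.
  rewrite t2rho (_ : del + del = ln (1 + e / 8)); last by rewrite /del; field.
  by rewrite lnK// posrE; lra.
have : expR (t ^+ 2 + del) / k%:R <= e / 8.
  rewrite ler_pdivrMr ?ltr0n// mulrC -ler_pdivrMr//.
  have := truncnS_gt (expR (t ^+ 2 + del) * 8 / e); rewrite -/k.
  have -> : expR (t ^+ 2 + del) / (e / 8) = expR (t ^+ 2 + del) * 8 / e.
    by field; rewrite gt_eqF.
  exact: ltW.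
lra.
Qed.
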